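(* Let $p_1$ be a probability density function with respect to $\mu$, and let $p_0$ be a non-negative function on $X$. Assume that $p_1$ is absolutely continuous with respect to $p_0$. Let $q\ge 0$ be such that $M_q(p_1,p_0)=\int p_1(x)^q p_0(x)^{1-q}\,\mathrm{d}\mu(x)<\infty$, and let $p_q$ be the generalized escort distribution with index $q$, $$p_q(x)=\frac{p_1(x)^q p_0(x)^{1-q}}{\int p_1(x)^q p_0(x)^{1-q}\,\mathrm{d}\mu(x)}.$$ Let $\eta\in\mathbb{R}$. If $E_q\left[\log\frac{p_1}{p_0}\right]$ is finite, where $E_q[\cdot]$ denotes expectation with respect to $p_q$, and if $q$ is chosen such that $D(p_q\|p_0)=\eta$, then $p_q$ is the unique solution of the problem $$\min_{p}\ D(p\|p_1)\quad\text{subject to}\quad D(p\|p_0)=\eta,\quad \int p(x)\,\mathrm{d}\mu(x)=1,$$ where the minimization is over probability densities $p$ with respect to $\mu$.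
   Context: $\mu$ is a general measure on a set $X$; all densities are (univariate) densities with respect to $\mu$. For a density $f$ and a non-negative function $g$, $D(f\|g)=\int f(x)\log\frac{f(x)}{g(x)}\,\mathrm{d}\mu(x)$ is the Kullback-Leibler divergence, with the conventions $0\log 0=0\log(0/a)=0\log(0/0)=0$ (and value $+\infty$ when $f$ is positive on a set of positive $\mu$-measure where $g=0$). ''$p_1$ absolutely continuous with respect to $p_0$'' means $p_1=0$ $\mu$-almost everywhere where $p_0=0$. The product $p_1^q p_0^{1-q}$ is taken to be $0$ where $p_0=p_1=0$. $E_q[h]=\int h(x)p_q(x)\,\mathrm{d}\mu(x)$. *)

(* Defs.v *)
From HB Require Import structures.
From mathcomp Require Import all_boot all_order all_algebra.
From mathcomp Require Import all_classical all_reals all_analysis.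

Set Implicit Arguments.
Unset Strict Implicit.
Unset Printing Implicit Defensive.
Import Order.TTheory GRing.Theory Num.Theory.
Import numFieldNormedType.Exports.

Local Open Scope classical_set_scope.
Local Open Scope ring_scope.
Local Open Scope ereal_scope.

Definition nonneg_measurable d (X : measurableType d) (R : realType)
    (f : X -> R) : Prop :=
  measurable_fun setT f /\ forall x, (0 <= f x)%R.

Definition prob_density d (X : measurableType d) (R : realType)
    (mu : {measure set X -> \bar R}) (f : X -> R) : Prop :=
  nonneg_measurable f /\ \int[mu]_x (f x)%:E = 1.

(* p1 = 0 mu-almost everywhere where p0 = 0, for pointwise functions (the
   library's [`<<] compares measures). *)
Definition abs_cont d (X : measurableType d) (R : realType)
    (mu : {measure set X -> \bar R}) (p1 p0 : X -> R) : Prop :=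
  {ae mu, forall x, p0 x = 0%R -> p1 x = 0%R}.

(* Kullback-Leibler divergence.  Since [ln 0 = 0] and [a / 0 = 0] in the
   library, the integrand vanishes wherever f = 0 (0 log 0 = 0 log (0/a) =
   0 log (0/0) = 0), and also where f > 0 = g; the latter set is null when the
   integral is used.  When the positive and negative parts of the integrand
   both have infinite integral, the library's convention +oo - oo = -oo makes
   the divergence -oo, so [KL mu f g = eta%:E] with [eta : R] entails that the
   integrand is integrable.  If f and g are probability densities this case
   does not arise. *)
Definition KL d (X : measurableType d) (R : realType)
    (mu : {measure set X -> \bar R}) (f g : X -> R) : \bar R :=
  if mu [set x | (0 < f x)%R /\ g x = 0%R] == 0
  then \int[mu]_x (f x * ln (f x / g x))%:E
  else +oo.

(* [0 `^ s = 0] for s != 0 and [0 `^ 0 = 1], so the product is 0 wherever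
   p0 = p1 = 0, for every q. *)
Definition escort_weight d (X : measurableType d) (R : realType)
    (p1 p0 : X -> R) (q : R) (x : X) : R :=
  ((p1 x) `^ q * (p0 x) `^ (1 - q))%R.

Definition escort_mass d (X : measurableType d) (R : realType)
    (mu : {measure set X -> \bar R}) (p1 p0 : X -> R) (q : R) : \bar R :=
  \int[mu]_x (escort_weight p1 p0 q x)%:E.

Definition escort d (X : measurableType d) (R : realType)
    (mu : {measure set X -> \bar R}) (p1 p0 : X -> R) (q : R) (x : X) : R :=
  (escort_weight p1 p0 q x / fine (escort_mass mu p1 p0 q))%R.

(* log (p1 / p0) with values in [-oo, +oo]: -oo where p1 = 0 < p0, and +oo
   where p0 = 0 < p1. *)
Definition log_ratio d (X : measurableType d) (R : realType)
    (p1 p0 : X -> R) (x : X) : \bar R :=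
  lne ((p1 x)%:E / (p0 x)%:E).

(* E_q[h], with 0 * (+oo) = 0 * (-oo) = 0 in the integrand; an undefined
   expectation (infinite positive and negative parts) takes the value -oo, so
   it is not finite. *)
Definition escort_expectation d (X : measurableType d) (R : realType)
    (mu : {measure set X -> \bar R}) (p1 p0 : X -> R) (q : R)
    (h : X -> \bar R) : \bar R :=
  \int[mu]_x (h x * (escort mu p1 p0 q x)%:E).

Definition feasible d (X : measurableType d) (R : realType)
    (mu : {measure set X -> \bar R}) (p0 : X -> R) (eta : R)
    (p : X -> R) : Prop :=
  prob_density mu p /\ KL mu p p0 = eta%:E.

Definition minimizer d (X : measurableType d) (R : realType)
    (mu : {measure set X -> \bar R}) (p1 p0 : X -> R) (eta : R)
    (p : X -> R) : Prop :=
  feasible mu p0 eta p /\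
  forall p', feasible mu p0 eta p' -> KL mu p p1 <= KL mu p' p1.

(* Densities are identified when they agree mu-almost everywhere. *)
Definition unique_minimizer d (X : measurableType d) (R : realType)
    (mu : {measure set X -> \bar R}) (p1 p0 : X -> R) (eta : R)
    (p : X -> R) : Prop :=
  minimizer mu p1 p0 eta p /\
  forall p', minimizer mu p1 p0 eta p' -> {ae mu, forall x, p' x = p x}.

(* Main.v *)
(** With M the total mass of p1^q p0^(1-q), every feasible p with D(p||p1)
    finite satisfies D(p||p_q) = q D(p||p1) + (1-q) eta + log M, because
    log p_q = q log p1 + (1-q) log p0 - log M wherever p > 0. The left-hand side
    vanishes at p = p_q, so subtracting gives
    q (D(p||p1) - D(p_q||p1)) = D(p||p_q) >= 0, and D(p||p1) <= D(p_q||p1)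
    forces D(p||p_q) = 0, that is p = p_q almost everywhere. This covers q = 0,
    where p_q is the only feasible density. *)
Require Import Defs.
From HB Require Import structures.
From mathcomp Require Import all_boot all_order all_algebra.
From mathcomp Require Import all_classical all_reals all_analysis.
From mathcomp Require Import measurable_realfun.
From mathcomp Require Import ring lra.

Set Implicit Arguments.
Unset Strict Implicit.
Import Order.TTheory GRing.Theory Num.Theory.

Local Open Scope classical_set_scope.
Local Open Scope ring_scope.
Local Open Scope ereal_scope.

(** * Integrability from bounds on the value of an extended integral *)

(** The integral is the difference of the integrals of the positive and negative parts, and +oo - oo
    = -oo, so a finite value forces both to be finite. *)
Lemma integral_fin_num_integrable (d : measure_display) (X : measurableType d)
    (R : realType) (mu : {measure set X -> \bar R}) (f : X -> \bar R) :
  measurable_fun setT f -> \int[mu]_x f x \is a fin_num ->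
  mu.-integrable setT f.
Proof.
move=> mf; rewrite integralE => fin.
have P0 : 0 <= \int[mu]_x f^\+ x by apply: integral_ge0.
have N0 : 0 <= \int[mu]_x f^\- x by apply: integral_ge0.
apply/integrableP; split => //.
rewrite -[fun x => _]/(abse \o f) fune_abse ge0_integralD//; last 2 first.
- exact: measurable_funepos.
- exact: measurable_funeneg.
move: P0 N0 fin.
by case: (\int[mu]_x f^\+ x) => [r| |]; case: (\int[mu]_x f^\- x) => [s| |] // *; rewrite -EFinD ltry.
Qed.

Lemma ae_eq_integrable (d : measure_display) (X : measurableType d)
    (R : realType) (mu : {measure set X -> \bar R}) (f g : X -> \bar R) :
  measurable_fun setT g -> {ae mu, forall x, f x = g x} ->
  mu.-integrable setT f -> mu.-integrable setT g.
Proof.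
move=> mg fg /integrableP[mf foo]; apply/integrableP; split => //.
rewrite -(@ae_eq_integral _ _ _ _ _ _ (abse \o f))//.
- exact: measurableT_comp.
- exact: measurableT_comp.
- by apply: filterS fg => x /= -> _.
Qed.

(** The negative part of [f] is dominated by that of [g], hence has finite integral; the upper bound
    on the integral of [f] then controls its positive part. *)
Lemma integrable_minorant (d : measure_display) (X : measurableType d)
    (R : realType) (mu : {measure set X -> \bar R}) (f g : X -> \bar R) :
  measurable_fun setT f -> mu.-integrable setT g ->
  {ae mu, forall x, g x <= f x} -> \int[mu]_x f x < +oo ->
  mu.-integrable setT f.
Proof.
move=> mf ig gf; have mg := measurable_int _ ig.
have : \int[mu]_x f^\- x < +oo.
  apply: (@le_lt_trans _ _ (\int[mu]_x g^\- x)); last first.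
    exact: integral_funeneg_lt_pinfty.
  apply: ae_ge0_le_integral => //.
  - exact: measurable_funeneg.
  - exact: measurable_funeneg.
  - apply: filterS gf => x gfx _; rewrite !funenegE.
    by rewrite ge_max !le_max lexx leeN2 gfx orbT.
move=> Noo; rewrite integralE => foo.
apply: integral_fin_num_integrable => //; rewrite integralE.
have P0 : 0 <= \int[mu]_x f^\+ x by apply: integral_ge0.
have N0 : 0 <= \int[mu]_x f^\- x by apply: integral_ge0.
move: P0 N0 Noo foo.
by case: (\int[mu]_x f^\+ x) => [r| |]; case: (\int[mu]_x f^\- x) => [s| |].
Qed.

Lemma integrable_lincomb (d : measure_display) (X : measurableType d)
    (R : realType) (mu : {measure set X -> \bar R}) (f g : X -> R) (r s : R) :
  mu.-integrable setT (EFin \o f) -> mu.-integrable setT (EFin \o g) ->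
  mu.-integrable setT (fun x => (r * f x + s * g x)%:E).
Proof.
move=> fi gi.
exact: (integrableD measurableT (integrableZl measurableT r fi)
  (integrableZl measurableT s gi)).
Qed.

Lemma integral_lincomb (d : measure_display) (X : measurableType d)
    (R : realType) (mu : {measure set X -> \bar R}) (f g : X -> R)
    (r s a b : R) :
  mu.-integrable setT (EFin \o f) -> mu.-integrable setT (EFin \o g) ->
  \int[mu]_x (f x)%:E = a%:E -> \int[mu]_x (g x)%:E = b%:E ->
  \int[mu]_x (r * f x + s * g x)%:E = (r * a + s * b)%:E.
Proof.
move=> fi gi fa gb.
under eq_integral do rewrite EFinD !EFinM.
rewrite integralD//; [|exact: integrableZl..].
by rewrite !integralZl// fa gb.
Qed.

(** * Pointwise inequality behind the nonnegativity of the divergence *)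

(* The Bregman form [a log (a / b) - a + b] is pointwise nonnegative, unlike the
   KL integrand, and has the same integral on densities. *)
Lemma divergence_ge0 (R : realType) (a b : R) :
  (0 <= a)%R -> (0 <= b)%R -> ((0 < a)%R -> (0 < b)%R) ->
  (0 <= a * ln (a / b) - a + b)%R.
Proof.
rewrite le0r => /orP[/eqP ->|a0] b0 ab; first by lra.
move/(_ a0) in ab.
(* The bound ln (1 + u) <= u at u = b / a - 1. *)
have : (ln (1 + (b / a - 1)) <= b / a - 1)%R.
  by apply: le_ln1Dx; rewrite ltrBDr addNr divr_gt0.
rewrite addrCA subrr addr0 => h.
have -> : ln (a / b) = (- ln (b / a))%R by rewrite -lnV ?posrE ?divr_gt0// invf_div.
have : (a * ln (b / a) <= a * (b / a - 1))%R by rewrite ler_pM2l.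
rewrite mulrBr mulrCA divff ?gt_eqF//; lra.
Qed.

(** Equality case: for a > 0 and b <> a, the strict bound 1 + t < exp t at t = ln (b / a) makes the
    form positive; for a = 0 the form is just b. *)
Lemma divergence_eq0 (R : realType) (a b : R) :
  (0 <= a)%R -> ((0 < a)%R -> (0 < b)%R) ->
  (a * ln (a / b) - a + b = 0)%R -> a = b.
Proof.
rewrite le0r => /orP[/eqP ->|a0] ab; first by lra.
move/(_ a0) in ab => e0.
apply/eqP/negPn/negP => neq.
have l0 : ln (b / a) != 0%R.
  rewrite ln_eq0 ?divr_gt0//; apply: contraNneq neq => /(congr1 ( *%R^~ a)).
  by rewrite divfK ?lt0r_neq0// mul1r => ->.
have := expR_gt1Dx l0; rewrite lnK ?posrE ?divr_gt0// => h.
have : (a * (1 + ln (b / a)) < a * (b / a))%R by rewrite ltr_pM2l.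
have -> : ln (b / a) = (- ln (a / b))%R by rewrite -lnV ?posrE ?divr_gt0// invf_div.
by rewrite (mulrCA a b) divff ?gt_eqF//; lra.
Qed.

(** * Measurability, support and finiteness for the divergence *)

Lemma measurable_ln_ratio (d : measure_display) (X : measurableType d)
    (R : realType) (f g : X -> R) :
  measurable_fun setT f -> nonneg_measurable g ->
  measurable_fun setT (fun x => ln (f x / g x))%R.
Proof.
move=> mf [mg g0]; apply: (measurableT_comp (@measurable_ln R)).
apply: measurable_funM => //.
(* Nonnegativity of [g] allows its inverse to be written as the power -1, a measurable function. *)
under eq_fun do rewrite -powR_inv1//.
exact: (measurableT_comp (measurable_powR _)).
Qed.

Lemma measurable_KL_integrand (d : measure_display) (X : measurableType d)
    (R : realType) (f g : X -> R) :
  measurable_fun setT f -> nonneg_measurable g ->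
  measurable_fun setT (fun x => (f x * ln (f x / g x))%:E).
Proof.
move=> mf mg; apply/measurable_EFinP; apply: measurable_funM => //.
exact: measurable_ln_ratio.
Qed.

Lemma measurable_pos_zero (d : measure_display) (X : measurableType d)
    (R : realType) (f g : X -> R) :
  measurable_fun setT f -> measurable_fun setT g ->
  measurable [set x | (0 < f x)%R /\ g x = 0%R].
Proof.
move=> mf mg.
have -> : [set x | (0 < f x)%R /\ g x = 0%R] =
    [set x | (0 < f x)%R && (g x == 0%R)].
  by apply/seteqP; split=> x /=;
    [move=> [-> ->]; rewrite eqxx|move=> /andP[-> /eqP]].
have mb : measurable_fun setT (fun x => (0 < f x)%R && (g x == 0%R)).
  by apply: measurable_and; [exact: measurable_fun_ltr|exact: measurable_fun_eqr].
by rewrite -[X in measurable X]setTI; exact: mb.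
Qed.

Lemma KL_support (d : measure_display) (X : measurableType d) (R : realType)
    (mu : {measure set X -> \bar R}) (f g : X -> R) :
  nonneg_measurable f -> nonneg_measurable g -> KL mu f g < +oo ->
  {ae mu, forall x, (0 < f x)%R -> (0 < g x)%R}.
Proof.
move=> [mf f0] [mg g0]; rewrite /KL; case: ifPn => [/eqP m0 _|]; last by rewrite ltxx.
exists [set x | (0 < f x)%R /\ g x = 0%R]; split => //.
  exact: measurable_pos_zero.
move=> x /= /not_implyP[fx]; by rewrite lt0r g0 andbT => /negP/negPn/eqP.
Qed.

Lemma KL_fin_num (d : measure_display) (X : measurableType d) (R : realType)
    (mu : {measure set X -> \bar R}) (f g : X -> R) :
  nonneg_measurable f -> nonneg_measurable g -> KL mu f g \is a fin_num ->
  mu.-integrable setT (fun x => (f x * ln (f x / g x))%:E) /\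
  KL mu f g = \int[mu]_x (f x * ln (f x / g x))%:E.
Proof.
move=> [mf f0] mg; rewrite /KL; case: ifPn => // _ fin; split => //.
apply: integral_fin_num_integrable => //.
exact: measurable_KL_integrand.
Qed.

Lemma prob_density_integrable (d : measure_display) (X : measurableType d)
    (R : realType) (mu : {measure set X -> \bar R}) (f : X -> R) :
  prob_density mu f -> mu.-integrable setT (EFin \o f).
Proof.
move=> [[mf f0] f1]; apply: integral_fin_num_integrable; last by rewrite f1.
exact/measurable_EFinP.
Qed.

(* The negative part is integrable since [f log (f / g) >= f - g]. *)
Lemma KL_lty_fin_num (d : measure_display) (X : measurableType d) (R : realType)
    (mu : {measure set X -> \bar R}) (f g : X -> R) :
  prob_density mu f -> prob_density mu g -> KL mu f g < +oo ->
  KL mu f g \is a fin_num.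
Proof.
move=> hf hg foo; have fi := prob_density_integrable hf.
have gi := prob_density_integrable hg.
case: hf hg => [[mf f0] f1] [[mg g0] g1].
have fg := KL_support (conj mf f0) (conj mg g0) foo.
move: foo; rewrite /KL; case: ifPn => // _ foo.
apply: integrable_fin_num => //; apply: integrable_minorant foo.
- exact: measurable_KL_integrand.
- exact: (@integrable_lincomb _ _ _ _ f g 1 (-1) fi gi).
- apply: filterS fg => x fgx; rewrite lee_fin.
  have := divergence_ge0 (f0 x) (g0 x) fgx; lra.
Qed.

(** * The escort distribution: normalization, logarithm and support *)

Lemma escort_weight_ge0 (d : measure_display) (X : measurableType d)
    (R : realType) (p1 p0 : X -> R) (q : R) (x : X) :
  (0 <= escort_weight p1 p0 q x)%R.
Proof. by rewrite mulr_ge0// powR_ge0. Qed.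

Lemma measurable_escort_weight (d : measure_display) (X : measurableType d)
    (R : realType) (p1 p0 : X -> R) (q : R) :
  measurable_fun setT p1 -> measurable_fun setT p0 ->
  measurable_fun setT (escort_weight p1 p0 q).
Proof.
by move=> m1 m0; apply: measurable_funM; exact: (measurableT_comp (measurable_powR _)).
Qed.

(** If the mass were 0, the weight would vanish almost everywhere, so [p1] or [p0] would be 0 there;
    absolute continuity then gives [p1] = 0 almost everywhere, against its integral being 1. *)
Lemma escort_mass_gt0 (d : measure_display) (X : measurableType d)
    (R : realType) (mu : {measure set X -> \bar R}) (p1 p0 : X -> R) (q : R) :
  prob_density mu p1 -> nonneg_measurable p0 -> abs_cont mu p1 p0 ->
  0 < escort_mass mu p1 p0 q.
Proof.
move=> [[m1 p1_ge0] I1] [m0 p0_ge0] ac.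
have w0 := escort_weight_ge0 p1 p0 q.
rewrite lt0e integral_ge0 ?andbT//; last by move=> x _; rewrite lee_fin.
have mw : measurable_fun setT (fun x => (escort_weight p1 p0 q x)%:E).
  by apply/measurable_EFinP; exact: measurable_escort_weight.
apply/eqP => M0.
have /(ae_eq_integral_abs mu measurableT mw).1 w_ae :
    \int[mu]_x `|(escort_weight p1 p0 q x)%:E| = 0.
  by rewrite -[RHS]M0; apply: eq_integral => x _; rewrite gee0_abs// lee_fin.
have : \int[mu]_x (p1 x)%:E = \int[mu]_x (cst 0 x).
  apply: ae_eq_integral => //; first exact/measurable_EFinP.
  apply: filterS2 ac w_ae => x ac wx _; move: (wx I) => /= [] /eqP.
  rewrite mulf_eq0 !powR_eq0 => /orP[|] /andP[/eqP z _]; rewrite ?z//.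
  by rewrite ac.
by rewrite I1 integral0 => -[] /eqP; rewrite oner_eq0.
Qed.

Lemma escort_prob_density (d : measure_display) (X : measurableType d)
    (R : realType) (mu : {measure set X -> \bar R}) (p1 p0 : X -> R) (q : R) :
  measurable_fun setT p1 -> measurable_fun setT p0 ->
  0 < escort_mass mu p1 p0 q < +oo -> prob_density mu (escort mu p1 p0 q).
Proof.
move=> m1 m0 /andP[M0 Moo]; have mw := measurable_escort_weight q m1 m0.
have w0 := escort_weight_ge0 p1 p0 q.
have c0 : (0 < fine (escort_mass mu p1 p0 q))%R by rewrite fine_gt0// M0.
split; first split.
- exact: measurable_funM.
- by move=> x; rewrite divr_ge0// ltW.
rewrite /escort; under eq_integral do rewrite mulrC EFinM.
rewrite integralZl//; last first.
  apply: integral_fin_num_integrable; first exact/measurable_EFinP.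
  by rewrite ge0_fin_numE ?ltW.
rewrite -/(escort_mass mu p1 p0 q) -[X in _ * X]fineK ?ge0_fin_numE ?ltW//.
by rewrite -EFinM mulVf// gt_eqF.
Qed.

Lemma ln_escort (d : measure_display) (X : measurableType d)
    (R : realType) (mu : {measure set X -> \bar R}) (p1 p0 : X -> R) (q : R)
    (x : X) :
  (0 < fine (escort_mass mu p1 p0 q))%R -> (0 < p1 x)%R -> (0 < p0 x)%R ->
  (0 < escort mu p1 p0 q x)%R /\
  ln (escort mu p1 p0 q x) =
    (q * ln (p1 x) + (1 - q) * ln (p0 x)
      - ln (fine (escort_mass mu p1 p0 q)))%R.
Proof.
move=> M0 h1 h0; split; first by rewrite divr_gt0// mulr_gt0// powR_gt0.
by rewrite ln_div ?posrE ?mulr_gt0 ?powR_gt0// lnM ?posrE ?powR_gt0// !ln_powR.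
Qed.

(** If exactly one of [p1], [p0] vanishes, the log-ratio is infinite, and so is its product with the
    positive escort value. If both vanish, the escort value itself is 0. *)
Lemma escort_support (d : measure_display) (X : measurableType d)
    (R : realType) (mu : {measure set X -> \bar R}) (p1 p0 : X -> R) (q : R)
    (x : X) :
  (0 <= p1 x)%R -> (0 <= p0 x)%R -> (0 < escort mu p1 p0 q x)%R ->
  log_ratio p1 p0 x * (escort mu p1 p0 q x)%:E \is a fin_num ->
  [/\ (0 < p1 x)%R, (0 < p0 x)%R &
   log_ratio p1 p0 x = (ln (p1 x) - ln (p0 x))%:E].
Proof.
move=> p1_ge0 p0_ge0 e0.
have e0' : 0 < (escort mu p1 p0 q x)%:E by rewrite lte_fin.
move: p1_ge0; rewrite le0r => /orP[/eqP z1|h1].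
  have z0 : p0 x != 0%R.
    apply/eqP => z0; move: e0; rewrite /escort /escort_weight z1 z0.
    (* 0^q * 0^(1-q) = 0^1 = 0; the exponent law applies at base 0 because the exponents sum to 1,
       not 0. *)
    rewrite -powRD addrC subrK ?powRr1 ?mul0r ?ltxx//.
    by rewrite oner_eq0.
  by rewrite /log_ratio z1 inver (negbTE z0) mul0e le0_lneNy// mulNyr gtr0_sg// mul1e.
move: p0_ge0; rewrite le0r => /orP[/eqP z0|h0].
  by rewrite /log_ratio z0 inve0 mulry gtr0_sg// mul1e /= mulyr gtr0_sg// mul1e.
move=> _; split => //.
by rewrite /log_ratio inver gt_eqF// -EFinM lne_EFin ?divr_gt0// ln_div.
Qed.

(** A finite expectation makes the integrand integrable, hence finite almost everywhere, and
    [escort_support] applies. Off the support of the escort density both integrands are 0. *)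
Lemma escort_log_integrable (d : measure_display) (X : measurableType d)
    (R : realType) (mu : {measure set X -> \bar R}) (p1 p0 : X -> R) (q : R) :
  nonneg_measurable p1 -> nonneg_measurable p0 ->
  nonneg_measurable (escort mu p1 p0 q) ->
  escort_expectation mu p1 p0 q (log_ratio p1 p0) \is a fin_num ->
  {ae mu, forall x, (0 < escort mu p1 p0 q x)%R ->
    (0 < p1 x)%R /\ (0 < p0 x)%R} /\
  mu.-integrable setT
    (fun x => (escort mu p1 p0 q x * (ln (p1 x) - ln (p0 x)))%:E).
Proof.
move=> [m1 g1] [m0 g0] [me ge] fin.
have mlr : measurable_fun setT (log_ratio p1 p0).
  (* A case split exhibits measurability. [p1] is tested first: where both densities vanish, 0 *
     (+oo) = 0 and the value is -oo. *)
  rewrite (_ : log_ratio p1 p0 = fun x => if p1 x == 0%R then -oo else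
      if p0 x == 0%R then +oo else (ln (p1 x / p0 x))%:E); last first.
    apply/funext => x; rewrite /log_ratio inver.
    case: ifPn => [/eqP z0|z0]; case: ifPn => [/eqP z1|z1].
    - by rewrite z1 mul0e le0_lneNy.
    - by rewrite mulry gtr0_sg ?mul1e// lt0r z1 g1.
    - by rewrite z1 mul0e le0_lneNy.
    - by rewrite -EFinM lne_EFin// divr_gt0// lt0r ?z0 ?z1 ?g0 ?g1.
  apply: measurable_fun_ifT => //; first exact: measurable_fun_eqr.
  apply: measurable_fun_ifT => //; first exact: measurable_fun_eqr.
  by apply/measurable_EFinP; exact: measurable_ln_ratio.
have mE : measurable_fun setT
    (fun x => log_ratio p1 p0 x * (escort mu p1 p0 q x)%:E).
  by apply: emeasurable_funM => //; exact/measurable_EFinP.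
have iE := integral_fin_num_integrable mE fin.
have fE := integrable_ae measurableT iE.
split.
  apply: filterS fE => x /(_ I) fx ex.
  by have [] := escort_support (g1 x) (g0 x) ex fx.
apply: ae_eq_integrable iE.
  apply/measurable_EFinP; apply: measurable_funM => //.
  by apply: measurable_funB; exact: (measurableT_comp (@measurable_ln R)).
apply: filterS fE => x /(_ I) fx; have := ge x.
rewrite le0r => /orP[/eqP ->|ex]; first by rewrite mule0 mul0r.
have [_ _ ->] := escort_support (g1 x) (g0 x) ex fx.
by rewrite -EFinM mulrC.
Qed.

(** On the support of p_q, log (p_q / p1) = (q - 1) (log p1 - log p0) - log M, so the integrand
    combines the integrable log-ratio term with p_q. *)
Lemma KL_escort_fin_num (d : measure_display) (X : measurableType d)
    (R : realType) (mu : {measure set X -> \bar R}) (p1 p0 : X -> R) (q : R) :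
  prob_density mu p1 -> nonneg_measurable p0 ->
  prob_density mu (escort mu p1 p0 q) ->
  (0 < fine (escort_mass mu p1 p0 q))%R ->
  escort_expectation mu p1 p0 q (log_ratio p1 p0) \is a fin_num ->
  KL mu (escort mu p1 p0 q) p1 \is a fin_num.
Proof.
move=> hp1 hp0 he M0 fin.
have [supp iE] := escort_log_integrable hp1.1 hp0 he.1 fin.
have := integrable_lincomb (q - 1) (- ln (fine (escort_mass mu p1 p0 q))) iE
  (prob_density_integrable he).
have [[m1 g1] _] := hp1; have [[me ge] _] := he.
set h := fun x => _; move=> ih.
rewrite /KL ifT; last first.
  apply/eqP/negligibleP; first exact: measurable_pos_zero.
  apply: negligibleS supp => x /= [ex z1] /(_ ex)[].
  by rewrite z1 ltxx.
apply: integrable_fin_num => //; apply: ae_eq_integrable ih.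
  exact: measurable_KL_integrand.
apply: filterS supp => x supp; rewrite /h; congr EFin.
have := ge x; rewrite le0r => /orP[/eqP ->|ex]; first by rewrite !mul0r !mulr0 addr0.
have [h1 h0] := supp ex; have [_ ln_e] := ln_escort M0 h1 h0.
rewrite [in RHS]ln_div ?posrE// ln_e; ring.
Qed.

(** * The divergence identity and the minimization *)

(** The Bregman form is used on the left so that a zero integral later yields pointwise equality.
    Leaving [p] arbitrary allows the choice p = p_q as well. *)
Lemma divergence_escort (d : measure_display) (X : measurableType d)
    (R : realType) (mu : {measure set X -> \bar R}) (p1 p0 p : X -> R)
    (q a b : R) :
  prob_density mu p1 -> nonneg_measurable p0 ->
  prob_density mu (escort mu p1 p0 q) -> prob_density mu p ->
  (0 < fine (escort_mass mu p1 p0 q))%R ->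
  KL mu p p1 = a%:E -> KL mu p p0 = b%:E ->
  {ae mu, forall x, (0 < p x)%R -> (0 < escort mu p1 p0 q x)%R} /\
  \int[mu]_x (p x * ln (p x / escort mu p1 p0 q x)
              - p x + escort mu p1 p0 q x)%:E =
    (q * a + (1 - q) * b + ln (fine (escort_mass mu p1 p0 q)))%:E.
Proof.
move=> hp1 hp0 he hp M0 KLa KLb.
have s1 : {ae mu, forall x, (0 < p x)%R -> (0 < p1 x)%R}.
  by apply: (KL_support hp.1 hp1.1); rewrite KLa ltry.
have s0 : {ae mu, forall x, (0 < p x)%R -> (0 < p0 x)%R}.
  by apply: (KL_support hp.1 hp0); rewrite KLb ltry.
have [|ia Ia] := @KL_fin_num _ _ _ mu _ _ hp.1 hp1.1; first by rewrite KLa.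
have [|ib Ib] := @KL_fin_num _ _ _ mu _ _ hp.1 hp0; first by rewrite KLb.
rewrite Ia in KLa; rewrite Ib in KLb.
have i1 := integrable_lincomb q (1 - q) ia ib.
have I1 := integral_lincomb q (1 - q) ia ib KLa KLb.
have ip := prob_density_integrable hp; have ie := prob_density_integrable he.
set c := ln _.
(* Expanding log p_q contributes c p, and the Bregman correction contributes - p + p_q; as both
   densities integrate to 1, this part has integral c. *)
have i2 := integrable_lincomb (c - 1) 1 ip ie.
have I2 := integral_lincomb (c - 1) 1 ip ie hp.2 he.2.
have I3 := integral_lincomb 1 1 i1 i2 I1 I2.
have i3 := integrable_lincomb 1 1 i1 i2.
have [[mp gp] _] := hp; have [[me ge] _] := he.
split.
  by apply: filterS2 s1 s0 => x s1 s0 px; have [] := ln_escort M0 (s1 px) (s0 px).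
have -> : (q * a + (1 - q) * b + c)%:E = (1 * (q * a + (1 - q) * b)
    + 1 * ((c - 1) * 1 + 1 * 1))%:E by congr EFin; ring.
rewrite -I3; apply: ae_eq_integral => //.
- apply/measurable_EFinP; apply: measurable_funD => //.
  by apply: measurable_funB => //; apply/measurable_EFinP; exact: measurable_KL_integrand.
- exact: measurable_int i3.
- apply: filterS2 s1 s0 => x s1 s0 _; congr EFin.
  have := gp x; rewrite le0r => /orP[/eqP ->|px]; first by rewrite !mul0r; ring.
  move: (s1 px) (s0 px) => h1 h0; have [he' ln_e] := ln_escort M0 h1 h0.
  have ln_pe : ln (p x / escort mu p1 p0 q x) = (ln (p x) -
      (q * ln (p1 x) + (1 - q) * ln (p0 x) - c))%R.
    by rewrite -ln_e -ln_div ?posrE.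
  rewrite ln_pe !ln_div ?posrE//; ring.
Qed.

Lemma KL_le_escort (d : measure_display) (X : measurableType d)
    (R : realType) (mu : {measure set X -> \bar R}) (p1 p0 p : X -> R)
    (q eta : R) :
  prob_density mu p1 -> nonneg_measurable p0 -> (0 <= q)%R ->
  prob_density mu (escort mu p1 p0 q) ->
  (0 < fine (escort_mass mu p1 p0 q))%R ->
  KL mu (escort mu p1 p0 q) p1 \is a fin_num ->
  KL mu (escort mu p1 p0 q) p0 = eta%:E ->
  feasible mu p0 eta p -> KL mu p p1 <= KL mu (escort mu p1 p0 q) p1 ->
  {ae mu, forall x, p x = escort mu p1 p0 q x}.
Proof.
move=> hp1 hp0 q0 he M0 KLe1 KLe0 [hp KLp0] le.
have KLp1 : KL mu p p1 \is a fin_num.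
  by apply: KL_lty_fin_num => //; apply: le_lt_trans le _; rewrite ltey_eq KLe1.
move: le; rewrite -(fineK KLp1) -(fineK KLe1) lee_fin => le.
(* At p = p_q the left side is 0, which fixes the constant: (1 - q) eta + log M = - q D(p_q||p1). *)
have [_] := divergence_escort hp1 hp0 he he M0 (esym (fineK KLe1)) KLe0.
have [supp] := divergence_escort hp1 hp0 he hp M0 (esym (fineK KLp1)) KLp0.
have [[mp gp] _] := hp; have [[me ge] _] := he.
set D := fun x => _; move=> Ip.
under eq_integral => x _.
  rewrite (_ : (_ - _ + _)%R = 0%R); last first.
    have := ge x; rewrite le0r => /orP[/eqP ->|ex]; first by rewrite mul0r subr0 addr0.
    by rewrite divff ?lt0r_neq0// ln1; ring.
  over.
rewrite integral0 => -[] e0.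
have mD : measurable_fun setT D.
  apply/measurable_EFinP; apply: measurable_funD => //.
  by apply: measurable_funB => //; apply/measurable_EFinP; exact: measurable_KL_integrand.
have D0 : {ae mu, forall x, 0 <= D x}.
  apply: filterS supp => x supp.
  by rewrite lee_fin divergence_ge0.
have ID : \int[mu]_x `|D x| = \int[mu]_x D x.
  apply: ae_eq_integral => //; first exact: measurableT_comp.
  by apply: filterS D0 => x D0 _; rewrite gee0_abs.
(* The integral of [D] equals q (D(p||p1) - D(p_q||p1)), which is at most 0 because q >= 0; as [D]
   is nonnegative almost everywhere, it vanishes almost everywhere. *)
have /(ae_eq_integral_abs mu measurableT mD).1 Dz : \int[mu]_x `|D x| = 0.
  apply/eqP; rewrite eq_le integral_ge0// andbT ID Ip lee_fin.
  by have := ler_wpM2l q0 le; lra.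
apply: filterS2 supp Dz => x supp /(_ I) [].
exact: divergence_eq0.
Qed.

Theorem theorem5 (d : measure_display) (X : measurableType d) (R : realType)
    (mu : {measure set X -> \bar R}) (p1 p0 : X -> R) (q eta : R)
    (hp1 : prob_density mu p1)
    (hp0 : nonneg_measurable p0)
    (hac : abs_cont mu p1 p0)
    (hq : (0 <= q)%R)
    (hM : escort_mass mu p1 p0 q < +oo)
    (hE : escort_expectation mu p1 p0 q (log_ratio p1 p0) \is a fin_num)
    (hD : KL mu (escort mu p1 p0 q) p0 = eta%:E) :
  unique_minimizer mu p1 p0 eta (escort mu p1 p0 q).
Proof.
have M0 := escort_mass_gt0 q hp1 hp0 hac.
have c0 : (0 < fine (escort_mass mu p1 p0 q))%R by rewrite fine_gt0// M0.
have he : prob_density mu (escort mu p1 p0 q).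
  by apply: escort_prob_density; [exact: hp1.1.1|exact: hp0.1|rewrite M0].
have KLe := KL_escort_fin_num hp1 hp0 he c0 hE.
(* This one fact serves both uniqueness and optimality. *)
have key p : feasible mu p0 eta p ->
    KL mu p p1 <= KL mu (escort mu p1 p0 q) p1 ->
    {ae mu, forall x, p x = escort mu p1 p0 q x}.
  exact: KL_le_escort.
split=> [|p [hp min_p]]; last by apply: key => //; exact: min_p.
(* A strictly better feasible [p] would agree with p_q almost everywhere, hence have the same
   divergence from [p1], a contradiction. *)
split=> // p hp; rewrite leNgt; apply/negP => lt.
have pe := key p hp (ltW lt); move: (lt).
have KLp : KL mu p p1 \is a fin_num.
  apply: KL_lty_fin_num => //; first exact: hp.1.
  by apply: lt_trans lt _; rewrite ltey_eq KLe.
have [ip ->] := KL_fin_num hp.1.1 hp1.1 KLp.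
have [ie ->] := KL_fin_num he.1 hp1.1 KLe.
rewrite (@ae_eq_integral _ _ _ _ _
  (fun x => (escort mu p1 p0 q x * ln (escort mu p1 p0 q x / p1 x))%:E))//.
- by rewrite ltxx.
- exact: measurable_int ip.
- exact: measurable_int ie.
- by apply: filterS pe => x /= -> _.
Qed.
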